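(* The map $I\mapsto I^*$ is a bijection from the set of all (two-sided) ideals of $F$ onto the set of all saturated graded ideals of $\bar F$ containing $C$.
   Context: $K$ is a field, $X=\{x_1,x_2,\ldots\}$ a finite or countable set of variables, $F=K\langle X\rangle$ the free associative algebra, $t$ a new variable, $\bar F=K\langle X\cup\{t\}\rangle$. Ideals are two-sided; $F$ and $\bar F$ are graded by total degree (every variable, including $t$, has degree 1), and ''homogeneous'' and ''graded'' refer to this grading. $\varphi:\bar F\to\bar F$ is the algebra endomorphism $x_i\mapsto x_i$, $t\mapsto1$, with image $F$. For an ideal $I\subset F$, the homogenization $I^*\subset\bar F$ is the largest graded ideal contained in $\varphi^{-1}(I)$, i.e. the ideal generated by all homogeneous elements of $\varphi^{-1}(I)$. $C=0^*$ is the largest graded ideal contained in $\ker\varphi$. For a graded ideal $J\subset\bar F$ containing $C$, its saturation is $\mathrm{Sat}(J)=\varphi(J)^*$, and $J$ is called saturated if $J=\mathrm{Sat}(J)$. *)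

(* Defs.v *)
From HB Require Import structures.
From mathcomp Require Import all_boot all_order all_algebra.
From mathcomp Require Import finmap.
From mathcomp Require Import boolp classical_sets functions.
From mathcomp Require Import monalg.

Set Implicit Arguments.
Unset Strict Implicit.
Unset Printing Implicit Defensive.

Import GRing.Theory.

Local Open Scope ring_scope.
Local Open Scope classical_set_scope.

(* The free associative algebra on X is the algebra of the monoid of words
   on X, so "fdeg" (the length of a word) gives the total degree. *)
Notation freeAlg K X := {malg K[{fmonom X}]}.

Definition is_ideal {R : nzRingType} (I : set R) : Prop :=
  [/\ I 0,
      forall x y, I x -> I y -> I (x + y),
      forall a x, I x -> I (a * x) &
      forall a x, I x -> I (x * a)].

Section Grading.
Context {K : fieldType} {Y : choiceType}.
Implicit Types (g : freeAlg K Y) (J : set (freeAlg K Y)).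

Definition hcomp (d : nat) g : freeAlg K Y :=
  [malg w in msupp g => if fdeg w == d then g@_w else 0].

(* 0 is homogeneous. *)
Definition homogeneous g : Prop :=
  exists d : nat, forall w, w \in msupp g -> fdeg w = d.

Definition is_graded_ideal J : Prop :=
  is_ideal J /\ forall g d, J g -> J (hcomp d g).

End Grading.

Section Homogenization.
Context {K : fieldType} {X : countType}.

(* In "option X", "Some x" is the variable x of X and "None" is the new
   variable t.  The endomorphism phi is corestricted to its image, the free
   algebra on X; it is the linear extension of the map sending a word to the
   product of the images of its letters. *)
Definition phi_letter (y : option X) : freeAlg K X :=
  if y is Some x then << fmu x >> else 1.

Definition phi_word (w : {fmonom (option X)}) : freeAlg K X :=
  \prod_(y <- w) phi_letter y.

Definition phi (g : freeAlg K (option X)) : freeAlg K X :=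
  mmap (fun c : K => c%:MP) phi_word g.

Lemma phi_wordM : mmorphism phi_word.
Proof.
split=> [u v|]; first by rewrite /phi_word fmM big_cat.
by rewrite /phi_word fm1 big_nil.
Qed.

HB.instance Definition _ := isMultiplicative.Build _ _ phi_word phi_wordM.

Lemma phi_is_additive : zmod_morphism phi.
Proof. exact: mmap_is_additive. Qed.

HB.instance Definition _ := GRing.isZmodMorphism.Build _ _ phi phi_is_additive.

Lemma phi_is_multiplicative : monoid_morphism phi.
Proof.
have [] : multiplicative phi; last by [].
apply: commr_mmap_is_multiplicative => g m m'.
rewrite /GRing.comm !malgM_def fgmulUg fgmulgU.
by apply: eq_bigr => k _; rewrite mul1m mulm1 mulrC.
Qed.

HB.instance Definition _ :=
  GRing.isMonoidMorphism.Build _ _ phi phi_is_multiplicative.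

Lemma phiC (c : K) : phi c%:MP = c%:MP.
Proof. exact: mmapC. Qed.

Lemma phi_word1 y : phi_word (fmu y) = phi_letter y.
Proof. by rewrite /phi_word fmU big_seq1. Qed.

Lemma phi_x (x : X) : phi << fmu (Some x) >> = << fmu x >>.
Proof. by rewrite /phi mmapU phi_word1 mul1r. Qed.

Lemma phi_t : phi << fmu None >> = 1.
Proof. by rewrite /phi mmapU phi_word1 mul1r. Qed.

(* [smallest is_ideal S] is the ideal generated by S. *)
Definition hmgz (I : set (freeAlg K X)) : set (freeAlg K (option X)) :=
  smallest is_ideal [set g | homogeneous g /\ I (phi g)].

Definition Cideal : set (freeAlg K (option X)) := hmgz [set 0].

Definition Sat (J : set (freeAlg K (option X))) :
  set (freeAlg K (option X)) := hmgz (phi @` J).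

End Homogenization.

(* Main.v *)
Require Import Defs.
From HB Require Import structures.
From mathcomp Require Import all_boot all_order all_algebra.
From mathcomp Require Import boolp classical_sets functions.
From mathcomp Require Import finmap monalg.

(** The map [I |-> I^*] is inverted by the direct image under [phi]; all of the
    theorem follows from the single identity [phi (I^* ) = I] ([phi_hmgz]).
    One inclusion holds because the preimage of [I] is an ideal that contains
    the generators of [I^*].  For the other, an element [f] of degree at most
    [d] is dehomogenized from the homogeneous element [homogenize d f] of
    degree [d], which pads every word of [f] with powers of [t].

    Injectivity is then immediate, and [I^*] is saturated since
    [Sat (I^* ) = (phi (I^* ))^* = I^*].  Conversely a saturated [J] is [I^*]
    for [I = phi J], which is an ideal because [phi] is surjective.  Finally
    [I^*] is graded because it is generated by homogeneous elements
    ([graded_smallest]), the product rule [hcompM] giving that the elements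
    whose components all lie in an ideal form an ideal. *)

Local Open Scope classical_set_scope.

Import GRing.Theory.

(** * Generated ideals *)

Section Ideals.
Local Open Scope ring_scope.

Lemma smallest_ideal {R : nzRingType} (S : set R) :
  is_ideal (smallest is_ideal S).
Proof.
split.
- by move=> I [[]].
- move=> x y Sx Sy I SI; case: (SI) => -[_ ID _ _] _.
  by apply: ID; [apply: Sx | apply: Sy].
- by move=> a x Sx I SI; case: (SI) => -[_ _ IMl _] _; apply: IMl; apply: Sx.
- by move=> a x Sx I SI; case: (SI) => -[_ _ _ IMr] _; apply: IMr; apply: Sx.
Qed.

Lemma ideal_sum {R : nzRingType} (I : set R) (T : Type) (r : seq T) (F : T -> R) :
  is_ideal I -> (forall i, I (F i)) -> I (\sum_(i <- r) F i).
Proof. by case=> I0 ID _ _ IF; apply: big_ind. Qed.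

Lemma preimage_ideal {R S : nzRingType} (f : {rmorphism R -> S}) (I : set S) :
  is_ideal I -> is_ideal (f @^-1` I).
Proof.
case=> I0 ID IMl IMr; split; rewrite /preimage /=.
- by rewrite rmorph0.
- by move=> x y; rewrite rmorphD; apply: ID.
- by move=> a x; rewrite rmorphM; apply: IMl.
- by move=> a x; rewrite rmorphM; apply: IMr.
Qed.

Lemma image_ideal {R S : nzRingType} (f : {rmorphism R -> S}) (I : set R) :
  (forall s, exists r, f r = s) -> is_ideal I -> is_ideal (f @` I).
Proof.
move=> f_surj [I0 ID IMl IMr]; split.
- by exists 0; rewrite ?rmorph0.
- move=> _ _ [x Ix <-] [y Iy <-].
  by exists (x + y); [exact: ID | rewrite rmorphD].
- move=> a _ [x Ix <-]; have [b <-] := f_surj a.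
  by exists (b * x); [exact: IMl | rewrite rmorphM].
- move=> a _ [x Ix <-]; have [b <-] := f_surj a.
  by exists (x * b); [exact: IMr | rewrite rmorphM].
Qed.

End Ideals.

(** * Homogeneous components *)

Section Components.
Local Open Scope ring_scope.
Context {K : fieldType} {Y : choiceType}.
Implicit Types (g h : freeAlg K Y) (w u v : {fmonom Y}).

Lemma mcoeff_hcomp d g w :
  mcoeff w (hcomp d g) = if fdeg w == d then mcoeff w g else 0.
Proof.
rewrite /hcomp mcoeffE.
by case: (boolP (w \in msupp g)) => [//|/mcoeff_outdom ->]; rewrite if_same.
Qed.

Lemma hcomp_is_additive d : zmod_morphism (@hcomp K Y d).
Proof.
move=> g h; apply/malgP => w.
by rewrite mcoeffB !mcoeff_hcomp; case: ifP => _; rewrite ?mcoeffB ?subr0.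
Qed.

HB.instance Definition _ d :=
  GRing.isZmodMorphism.Build _ _ (@hcomp K Y d) (hcomp_is_additive d).

Lemma hcompU d (c : K) w :
  hcomp d << c *g w >> = if fdeg w == d then << c *g w >> else 0.
Proof.
apply/malgP => u; rewrite mcoeff_hcomp.
have [<-|/negPf wu] := eqVneq w u.
  by case: ifP; rewrite ?mcoeff0.
by rewrite mcoeffU wu mulr0n if_same; case: ifP; rewrite ?mcoeff0 ?mcoeffU ?wu.
Qed.

Lemma hcompM d g h :
  hcomp d (g * h) = \sum_(i < d.+1) hcomp i g * hcomp (d - i) h.
Proof.
(* Both sides are biadditive in g and h, so scaled words suffice: there only
   the summand of index fdeg u can survive. *)
rewrite (monalgE g) (monalgE h); move: (mcoeff ^~ g) (mcoeff ^~ h) => a b.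
rewrite mulr_suml raddf_sum.
under [RHS]eq_bigr => i _ do rewrite raddf_sum mulr_suml.
rewrite exchange_big /=; apply: eq_bigr => u _.
rewrite mulr_sumr raddf_sum.
under [RHS]eq_bigr => i _ do rewrite raddf_sum mulr_sumr.
rewrite exchange_big /=; apply: eq_bigr => v _.
rewrite malgM_def fgmulUU hcompU fdegM.
under eq_bigr => i _ do rewrite !hcompU.
case: (leqP (fdeg u) d) => [le_ud|lt_du].
  rewrite (bigD1 (Ordinal (le_ud : fdeg u < d.+1)%N)) //= eqxx.
  rewrite big1 => [|i /eqP ne_iu]; last first.
    rewrite ifF ?mul0r //; apply/eqP => ui; apply: ne_iu.
    by apply/val_inj.
  rewrite addr0 -(eqn_add2l (fdeg u) (fdeg v)) subnKC //.
  by case: ifP; rewrite ?mulr0 // malgM_def fgmulUU.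
rewrite big1 => [|i _]; last first.
  by rewrite gtn_eqF ?mul0r // (leq_trans (ltn_ord i)).
by rewrite gtn_eqF // ltn_addr.
Qed.

Lemma hcomp_fixed_homogeneous d g : hcomp d g = g -> homogeneous g.
Proof.
move=> gd; exists d => w; rewrite -mcoeff_neq0 -gd mcoeff_hcomp.
by have [//|_] := eqVneq (fdeg w) d; rewrite eqxx.
Qed.

Lemma hcomp_homogeneous d g :
  homogeneous g -> hcomp d g = g \/ hcomp d g = 0.
Proof.
case=> e ge; have [<-|ne_ed] := eqVneq e d; [left|right]; apply/malgP => w.
  rewrite mcoeff_hcomp; case: ifPn => // /eqP we.
  by rewrite mcoeff_outdom //; apply/negP => /ge.
rewrite mcoeff_hcomp mcoeff0; case: ifPn => // /eqP wd.
rewrite mcoeff_outdom //; apply/negP => /ge we.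
by move: ne_ed; rewrite -we wd eqxx.
Qed.

(** The elements all of whose components lie in the generated ideal contain
    the generators, and by the product rule they form an ideal. *)
Lemma graded_smallest (S : set (freeAlg K Y)) :
  S `<=` homogeneous -> is_graded_ideal (smallest is_ideal S).
Proof.
move=> S_hom; have idS := smallest_ideal S; split=> // g + Sg.
have [S0 SD SMl SMr] := idS.
pose T := [set h | forall e, smallest is_ideal S (hcomp e h)].
suff: T g by exact.
apply: Sg; split=> [|h Sh e]; last first.
  case: (hcomp_homogeneous e h (S_hom h Sh)) => ->; last exact: S0.
  by move=> I [_ SI]; apply: SI.
split.
- by move=> d; rewrite raddf0.
- by move=> x y Sx Sy d; rewrite raddfD; apply: SD; [exact: Sx | exact: Sy].
- move=> a x Sx d; rewrite hcompM; apply: (ideal_sum _ _ _ _ idS) => i.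
  by apply: SMl; exact: Sx.
- move=> a x Sx d; rewrite hcompM; apply: (ideal_sum _ _ _ _ idS) => i.
  by apply: SMr; exact: Sx.
Qed.

End Components.

(** * Homogenization *)

Section Homogenize.
Local Open Scope ring_scope.
Context {K : fieldType} {X : countType}.
Implicit Types (w : {fmonom X}) (f : freeAlg K X).

Definition pad_word d w : {fmonom (option X)} :=
  FMonom (nseq (d - fdeg w) None ++ map Some w).

(** Since the subtraction in the padding is truncated, this is homogeneous of
    degree [d] only when [f] has degree at most [d]; it is a lift of [f] along
    [phi] for every [d]. *)
Definition homogenize d f : freeAlg K (option X) :=
  \sum_(w <- msupp f) << mcoeff w f *g pad_word d w >>.

Lemma prod_letters w : \prod_(x <- w) << fmu x >> = << w >> :> freeAlg K X.
Proof.
case: w => s /=; elim: s => [|x s IHs].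
  by rewrite big_nil -mpolyC1E; congr << _ *g _ >>; apply/eqP; rewrite fmP fm1.
rewrite big_cons IHs malgM_def fgmulUU mulr1; congr << _ *g _ >>.
by apply/eqP; rewrite fmP fmM fmU.
Qed.

Lemma phi_pad_word d w : phi_word (pad_word d w) = << w >> :> freeAlg K X.
Proof.
rewrite /phi_word big_cat big_map big_nseq /= -prod_letters.
by elim: (d - _)%N => [|n IHn] /=; rewrite mul1r.
Qed.

Lemma phi_homogenize d f : phi (homogenize d f) = f.
Proof.
rewrite [RHS]monalgE /homogenize raddf_sum; apply: eq_bigr => w _.
rewrite /= /phi mmapU phi_pad_word mul_malgC; apply/malgP => u.
by rewrite mcoeffZ !mcoeffU mulr_natr.
Qed.

Lemma homogenize_homogeneous d f :
  (forall w, w \in msupp f -> fdeg w <= d)%N -> homogeneous (homogenize d f).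
Proof.
move=> f_le; apply: (@hcomp_fixed_homogeneous _ _ d); rewrite raddf_sum.
apply: eq_big_seq => w /f_le le_wd; rewrite /= hcompU ifT //.
by rewrite fdegE size_cat size_nseq size_map -fdegE subnK.
Qed.

Lemma phi_surj f : exists g, phi g = f.
Proof. by exists (homogenize 0 f); apply: phi_homogenize. Qed.

Lemma phi_hmgz (I : set (freeAlg K X)) : is_ideal I -> phi @` hmgz I = I.
Proof.
move=> idI; apply/seteqP; split=> [_ [g Ig <-]|f If].
  have := Ig (phi @^-1` I); apply; split; first exact: preimage_ideal.
  by move=> h [].
(* mmeasure exceeds the length of every word of the support. *)
exists (homogenize (mmeasure (@fdeg X) f) f); last exact: phi_homogenize.
move=> J [_ genJ]; apply: genJ; split; last by rewrite phi_homogenize.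
apply: homogenize_homogeneous => w /mmeasure_mnm_lt lt_wf.
exact: ltnW (lt_wf (@fdeg X)).
Qed.

Lemma hmgz_graded (I : set (freeAlg K X)) : is_graded_ideal (hmgz I).
Proof. by apply: graded_smallest => g []. Qed.

Lemma hmgzS (I J : set (freeAlg K X)) : I `<=` J -> hmgz I `<=` hmgz J.
Proof.
move=> IJ g Ig M [idM genM]; apply: Ig; split=> // h [hom_h Ih].
by apply: genM; split=> //; apply: IJ.
Qed.

End Homogenize.

Theorem mainTheorem4 (K : fieldType) (X : countType) :
  set_bij [set I : set (freeAlg K X) | is_ideal I]
          [set J : set (freeAlg K (option X)) |
            [/\ is_graded_ideal J, Cideal `<=` J & J = Sat J]]
          hmgz.
Proof.
split=> [I idI|I J /set_mem idI /set_mem idJ eqIJ|J [[idJ _] _ satJ]].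
- split; first exact: hmgz_graded.
  + by apply: hmgzS => _ ->; case: idI.
  + by rewrite /Sat phi_hmgz.
- by rewrite -(phi_hmgz I) // eqIJ phi_hmgz.
- by exists (phi @` J); first exact: (image_ideal _ _ phi_surj).
Qed.
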